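(* Let $s \in S_d(q)$ be a \begin{itemize} \item a type 1 generator of $\Gamma_d(q)$ of the form $\left( \begin{array}{cc} t+l_i & b \\ 0 & 1 \end{array} \right)$, or \item a type 2 generator of the form $\left( \begin{array}{cc} (t+l_i)(t+l_j)^{-1} & b(t+l_j)^{-1} \\ 0 & 1 \end{array} \right)$ \end{itemize} where $1 \leq i,j \leq d-1$, $i < j$ and $b \in \mathbb{Z}_q$. The language ${\mathcal L}_s = \{ \otimes(\nu(g),\nu(gs)) | g \in \Gamma_d(q) \}$ is a regular language.
   Context: Setting: $d \geq 3$, the coefficient ring is $\mathbb{Z}_q$, and $l_1,\dots,l_{d-1} \in \mathbb{Z}_q$ are distinct elements whose pairwise differences are invertible and which are themselves invertible. Let $\mathcal{R}_d = \mathbb{Z}_q[t,(t+l_1)^{-1},\dots,(t+l_{d-1})^{-1}]$. The Diestel-Leader group $\Gamma_d(q)$ is the group of affine matrices $g=\begin{pmatrix} (t+l_1)^{m_1}\cdots(t+l_{d-1})^{m_{d-1}} & R\\ 0 & 1\end{pmatrix}$ with $m_k \in \mathbb{Z}$, $R \in \mathcal{R}_d$, with finite generating set $S_d(q)$ consisting of the matrices $\begin{pmatrix} t+l_i & b\\ 0&1\end{pmatrix}^{\pm1}$ and $\begin{pmatrix} (t+l_i)(t+l_j)^{-1} & -b(t+l_j)^{-1}\\ 0&1\end{pmatrix}$ for $b\in\mathbb{Z}_q$, $i\neq j$. $\nu(g)$ denotes the normal form of $g$: with $R' = \prod_{k=1}^{d-1}(t+l_k)^{-m_k}R$ decomposed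 uniquely as $R_1+\cdots+R_d$ (for $i<d$, $R_i$ a polynomial in $t+l_i$ with only negative-degree terms; $R_d$ a polynomial in $t^{-1}$ with only non-positive-degree terms), $\nu(g)$ is the concatenation of the prefix string $\epsilon_1^{m_1}\#\cdots\#\epsilon_{d-1}^{m_{d-1}}$ over $\{x,y,\#\}$ ($|m_i|$ copies of $\epsilon_i$, with $\epsilon_i=x$ if $m_i>0$, $y$ if $m_i<0$, omitted if $m_i=0$) and the suffix string $S_1\#\cdots\#S_d$ over $\{\#\}\cup\mathbb{Z}_q$, where $S_i$ lists the coefficients of $R_i$ from degree $-1$ (degree $0$ for $i=d$) down to its minimal degree, empty if $R_i=0$. For words $w_1,w_2$, the convolution $\otimes(w_1,w_2)$ is the word of length $\max|w_i|$ over pairs of letters whose $k$-th letter is the pair of $k$-th letters of $w_1,w_2$, padded with a new symbol $\diamond$ when a word is shorter. *)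

(* Defs.v *)
From HB Require Import structures.
From mathcomp Require Import all_boot all_order all_algebra.
Set Implicit Arguments. Unset Strict Implicit. Unset Printing Implicit Defensive.
Import Order.TTheory GRing.Theory Num.Theory.
Local Open Scope ring_scope.

Record dfa (A : finType) := DFA {
  dfa_state : finType;
  dfa_s0 : dfa_state;
  dfa_final : dfa_state -> bool;
  dfa_trans : dfa_state -> A -> dfa_state }.
Arguments dfa_s0 {A} d.
Arguments dfa_final {A} d _.
Arguments dfa_trans {A} d _ _.

Definition dfa_accept (A : finType) (M : dfa A) (w : seq A) : bool :=
  dfa_final M (foldl (dfa_trans M) (dfa_s0 M) w).

Definition regular (A : finType) (L : seq A -> Prop) : Prop :=
  exists M : dfa A, forall w, L w <-> dfa_accept M w.

(* ---------- Convolution of words; None plays the role of the padding symbol ⋄ ---------- *)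
Definition conv (A : Type) (w1 w2 : seq A) : seq (option A * option A) :=
  mkseq (fun k => (onth w1 k, onth w2 k)) (maxn (size w1) (size w2)).

Section Letters.
Variable q : nat.
Inductive letter := LX | LY | LHash | LC of 'Z_q.
Definition letter_enc (a : letter) : option bool + 'Z_q :=
  match a with LX => inl (Some true) | LY => inl (Some false)
             | LHash => inl None | LC c => inr c end.
Definition letter_dec (x : option bool + 'Z_q) : letter :=
  match x with inl (Some true) => LX | inl (Some false) => LY
             | inl None => LHash | inr c => LC c end.
Lemma letter_encK : cancel letter_enc letter_dec. Proof. by case. Qed.
HB.instance Definition _ := Finite.copy letter (pcan_type (can_pcan letter_encK)).
End Letters.

Definition hash_join (q : nat) (ss : seq (seq (letter q))) : seq (letter q) :=
  match ss with
  | [::] => [::]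
  | s :: ss' => s ++ flatten [seq LHash q :: t | t <- ss']
  end.

Definition posn (x : int) : nat := if x is Posz k then k else 0%N.

Section DL.
Variables (q n : nat).
(* n = d - 1 ; l k = l_{k+1} *)
Variable l : 'I_n -> 'Z_q.

Definition lin (k : 'I_n) : {poly 'Z_q} := 'X + (l k)%:P.

(* an element p * prod_k (t+l_k)^(z_k) of R_d, with z_k integers *)
Definition frac := ({poly 'Z_q} * {ffun 'I_n -> int})%type.

(* equality in R_d (localization of Z_q[t] at the non-zero-divisors t+l_k) *)
Definition frac_eq (f g : frac) : Prop :=
  f.1 * \prod_(k < n) lin k ^+ posn (f.2 k - g.2 k)
  = g.1 * \prod_(k < n) lin k ^+ posn (g.2 k - f.2 k).

Definition frac_add (f g : frac) : frac :=
  (f.1 * \prod_(k < n) lin k ^+ posn (f.2 k - g.2 k)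
   + g.1 * \prod_(k < n) lin k ^+ posn (g.2 k - f.2 k),
   [ffun k => Order.min (f.2 k) (g.2 k)]).

(* multiplication by prod_k (t+l_k)^(m_k) *)
Definition frac_shift (m : {ffun 'I_n -> int}) (f : frac) : frac :=
  (f.1, [ffun k => f.2 k + m k]).

(* group element ( prod_k (t+l_k)^(m_k)   R ; 0  1 ) represented by (m, R) *)
Definition gelt := ({ffun 'I_n -> int} * frac)%type.

Definition gmul (g h : gelt) : gelt :=
  ([ffun k => g.1 k + h.1 k], frac_add g.2 (frac_shift g.1 h.2)).

Definition gen1 (i : 'I_n) (b : 'Z_q) : gelt :=
  ([ffun k => ((k == i) : nat)%:Z], (b%:P, [ffun _ => 0])).

Definition gen2 (i j : 'I_n) (b : 'Z_q) : gelt :=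
  ([ffun k => ((k == i) : nat)%:Z - ((k == j) : nat)%:Z],
   (b%:P, [ffun k => - ((k == j) : nat)%:Z])).

Definition Rprime (g : gelt) : frac := frac_shift [ffun k => - g.1 k] g.2.

(* R_i = sum_{k < size c} c_k (t+l_i)^(-(k+1)), coefficient list S_i = polyseq c *)
Definition frac_place (i : 'I_n) (c : {poly 'Z_q}) : frac :=
  (\sum_(k < size c) (c`_k)%:P * lin i ^+ (size c - k.+1),
   [ffun k' => - (((k' == i) : nat) * size c)%N%:Z]).

Definition decomp_sum (c : 'I_n -> {poly 'Z_q}) (cd : {poly 'Z_q}) : frac :=
  foldr frac_add (cd, [ffun _ => 0]) [seq frac_place i (c i) | i <- enum 'I_n].

Definition nf_prefix (m : {ffun 'I_n -> int}) : seq (letter q) :=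
  hash_join [seq nseq `|m k|%N (if 0 <= m k then LX q else LY q) | k <- enum 'I_n].

Definition nf_suffix (c : 'I_n -> {poly 'Z_q}) (cd : {poly 'Z_q}) : seq (letter q) :=
  hash_join ([seq map (@LC q) (polyseq (c k)) | k <- enum 'I_n]
             ++ [:: map (@LC q) (polyseq cd)]).

(* w is the normal form nu(g) (the decomposition is unique, so this is a function) *)
Definition is_nf (g : gelt) (w : seq (letter q)) : Prop :=
  exists (c : 'I_n -> {poly 'Z_q}) (cd : {poly 'Z_q}),
    frac_eq (Rprime g) (decomp_sum c cd) /\ w = nf_prefix g.1 ++ nf_suffix c cd.

Definition lang (s : gelt) (w : seq (option (letter q) * option (letter q))) : Prop :=
  exists (g : gelt) (w1 w2 : seq (letter q)),
    is_nf g w1 /\ is_nf (gmul g s) w2 /\ w = conv w1 w2.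
End DL.

(* Main.v *)
(* Write u_k = t + l_k and R' for the matrix entry of g divided by prod u_k^(m_k).  Right
   multiplication by s replaces R' by R'' with u_i R'' = p R' + b, where p = 1 (type 1) or
   p = u_j (type 2).  Since u_j = u_k + (l_j - l_k), in terms of the coefficient strings of the
   partial fractions this is a local condition: the a-th and (a+1)-st coefficients of the two
   strings satisfy a fixed linear equation, except that the constant terms of the polynomial
   parts involve the sum of the first coefficients of the other strings, which takes
   finitely many values.  Hence each pair of blocks of nu(g) and nu(gs) is recognised by a
   finite automaton, and corresponding blocks differ in length by at most 2.  The two tapes
   thus stay aligned up to a bounded delay, which a finite buffer absorbs, so the convolution of
   the concatenated blocks is regular. *)
Require Import Defs.
From HB Require Import structures.
From mathcomp Require Import all_boot all_order all_algebra.
From mathcomp Require Import boolp zify ring.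
Import Order.TTheory GRing.Theory Num.Theory.
Set Implicit Arguments. Unset Strict Implicit. Unset Printing Implicit Defensive.

(** * Languages with finitely many residuals *)

(** [phi] is only asked to separate words with different residuals, not to be computable letter by
    letter, so a closure property comes down to saying what to remember of the word read so far. *)
Definition fin_index (A : Type) (L : seq A -> Prop) : Prop :=
  exists (F : finType) (phi : seq A -> F),
    forall u v, phi u = phi v -> forall w, L (u ++ w) -> L (v ++ w).

Section FiniteIndex.
Variable A : Type.
Implicit Types (L : seq A -> Prop) (u v w : seq A).

Lemma fin_index_ext L L' : (forall w, L w <-> L' w) -> fin_index L -> fin_index L'.
Proof.
move=> LL' [F [phi phiP]]; exists F, phi => u v uv w /LL' Lw.
by apply/LL'; apply: phiP Lw.
Qed.

Lemma fin_indexI L1 L2 :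
  fin_index L1 -> fin_index L2 -> fin_index (fun w => L1 w /\ L2 w).
Proof.
move=> [F1 [phi1 phi1P]] [F2 [phi2 phi2P]].
exists (F1 * F2)%type, (fun u => (phi1 u, phi2 u)) => u v [uv1 uv2] w [L1w L2w].
by split; [apply: phi1P L1w | apply: phi2P L2w].
Qed.

Lemma fin_indexU L1 L2 :
  fin_index L1 -> fin_index L2 -> fin_index (fun w => L1 w \/ L2 w).
Proof.
move=> [F1 [phi1 phi1P]] [F2 [phi2 phi2P]].
exists (F1 * F2)%type, (fun u => (phi1 u, phi2 u)) => u v [uv1 uv2] w [L1w|L2w].
  by left; apply: phi1P L1w.
by right; apply: phi2P L2w.
Qed.

(** Levi's lemma: two factorisations of one word have a common refinement, whose shape depends on
    which cut comes first. *)
Lemma cat_eq_cat u w a b : u ++ w = a ++ b ->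
  (exists c, u = a ++ c /\ b = c ++ w) \/ (exists c, a = u ++ c /\ w = c ++ b).
Proof.
elim: u a => [|x u IH] [|y a] /=.
- by move=> ->; left; exists [::].
- by move=> ->; right; exists (y :: a).
- by move=> <-; left; exists (x :: u).
case=> -> /IH [[c [-> ->]]|[c [-> ->]]]; first by left; exists c.
by right; exists c.
Qed.

(** The cut falls inside [u] or after it. Hence it suffices to remember the class of [u] for [L1]
    and the set of [L2]-classes of what remains of [u] behind its prefixes in [L1]. *)
Lemma fin_index_cat L1 L2 :
  fin_index L1 -> fin_index L2 ->
  fin_index (fun w => exists u v, [/\ L1 u, L2 v & w = u ++ v]).
Proof.
move=> [F1 [phi1 phi1P]] [F2 [phi2 phi2P]].
pose cut u f := exists u1 u2, [/\ u = u1 ++ u2, L1 u1 & phi2 u2 = f].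
exists (F1 * {set F2})%type, (fun u => (phi1 u, [set f | `[< cut u f >]])).
move=> u v [uv1 /setP uv2] w [a [b [La Lb /cat_eq_cat [[c [Eu Eb]]|[c [Ea Ew]]]]]].
  have /asboolP : `[< cut v (phi2 c) >].
    by have := uv2 (phi2 c); rewrite !inE => <-; apply/asboolP; exists a, c.
  move=> [v1 [v2 [-> L1v1 v2c]]]; exists v1, (v2 ++ w); split; rewrite ?catA //.
  by apply: phi2P (esym v2c) _ _; rewrite -Eb.
exists (v ++ c), b; split=> //; last by rewrite -catA -Ew.
by apply: phi1P uv1 _ _; rewrite -Ea.
Qed.

Lemma fin_index_path (T : finType) (h : A -> T) (e : rel T) (x0 : T) (f : pred T) :
  fin_index (fun w => path e x0 (map h w) && f (last x0 (map h w))).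
Proof.
exists (bool * T)%type, (fun u => (path e x0 (map h u), last x0 (map h u))).
by move=> u v [pE lE] w; rewrite !map_cat !cat_path !last_cat pE lE.
Qed.

Lemma fin_index_all (p : pred A) : fin_index (all p).
Proof.
by exists bool, (all p) => u v E w; rewrite !all_cat E.
Qed.

End FiniteIndex.

Lemma fin_index_map (A B : Type) (h : B -> A) (L : seq A -> Prop) :
  fin_index L -> fin_index (fun w => L (map h w)).
Proof.
move=> [F [phi phiP]]; exists F, (fun u => phi (map h u)) => u v uv w.
by rewrite !map_cat; apply: phiP.
Qed.

(** A prefix of [w0] is determined by its length, and all other words have an empty residual. *)
Lemma fin_index_word (A : eqType) (w0 : seq A) : fin_index (eq^~ w0).
Proof.
exists (option 'I_(size w0).+1),
  (fun u => if prefix u w0 then Some (inord (size u)) else None).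
move=> u v uv w Ew; have pu : prefix u w0 by apply/prefixP; exists w.
have sz x : prefix x w0 -> size x < (size w0).+1 by move=> /size_prefix.
move: uv; rewrite pu; case: ifP => // pv [] /(congr1 val).
rewrite /= !inordK ?sz // => Euv.
move: pu pv; rewrite !prefixE -Euv => /eqP Eu /eqP Ev.
by rewrite -Ev Eu.
Qed.

(* Myhill-Nerode: the state reached after a letter is computed from an arbitrary
   word in the current class, since words of one class have equal residuals. *)
Lemma fin_index_regular (A : finType) (L : seq A -> Prop) :
  fin_index L -> regular L.
Proof.
move=> [F [phi phiP]].
have repP f : exists u, (exists v, phi v = f) -> phi u = f.
  by case: (pselect (exists v, phi v = f)) => [[v vf]|nv]; [exists v|exists [::]].
have [rep rep_phi] := choice repP.
have phi_rep u : phi (rep (phi u)) = phi u by apply: rep_phi; exists u.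
pose M := @DFA A F (phi [::]) (fun f => `[< L (rep f) >])
            (fun f a => phi (rcons (rep f) a)).
exists M => w; rewrite /dfa_accept /=.
suff [u [-> /(_ [::])]] : exists u,
    foldl (dfa_trans M) (phi [::]) w = phi u /\ forall z, L (u ++ z) <-> L (w ++ z).
  rewrite !cats0 => <-; split=> [Lu|/asboolP Lu].
    apply/asboolP; rewrite -[rep _]cats0.
    by apply: (phiP u); rewrite ?phi_rep ?cats0.
  by rewrite -[u]cats0; apply: (phiP (rep (phi u))); rewrite ?phi_rep ?cats0.
elim/last_ind: w => [|w a [u [Eu uw]]]; first by exists [::].
rewrite foldl_rcons Eu /=; exists (rcons (rep (phi u)) a); split=> // z.
rewrite !cat_rcons -uw; split; apply: phiP; by rewrite phi_rep.
Qed.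

(** * Convolutions as padded two-tape words, and realignment of tapes with bounded delay *)

Section Convolution.
Variable A : Type.
Implicit Types (w : seq A) (v : seq (option A * option A)).

Definition fst_word v : seq A := pmap fst v.
Definition snd_word v : seq A := pmap snd v.

Definition padded (x : seq (option A)) : Prop :=
  exists w i, x = map Some w ++ nseq i None.

Lemma mkseq_onth w k :
  size w <= k -> mkseq (onth w) k = map Some w ++ nseq (k - size w) None.
Proof.
move=> lewk; apply: (@eq_from_nth _ None).
  by rewrite size_mkseq size_cat size_map size_nseq subnKC.
rewrite size_mkseq => i ltik; rewrite nth_mkseq // nth_cat size_map -onthE.
case: ltnP => // le_wi; rewrite nth_nseq if_same.
by rewrite onth_default.
Qed.

Lemma unzip1_conv w1 w2 : exists i, unzip1 (conv w1 w2) = map Some w1 ++ nseq i None.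
Proof.
rewrite /conv /unzip1 /mkseq -map_comp /= -[map _ _]/(mkseq (onth w1) _).
by rewrite mkseq_onth ?leq_maxl //; eexists.
Qed.

Lemma unzip2_conv w1 w2 : exists i, unzip2 (conv w1 w2) = map Some w2 ++ nseq i None.
Proof.
rewrite /conv /unzip2 /mkseq -map_comp /= -[map _ _]/(mkseq (onth w2) _).
by rewrite mkseq_onth ?leq_maxr //; eexists.
Qed.

Lemma pmap_padded w i k :
  pmap id (take k (map Some w ++ nseq i None)) = take k w.
Proof.
elim: w k => [k|a w IH [|k] //=]; last by rewrite IH.
by elim: i k => [|i IH] [|k] //=; rewrite IH.
Qed.

Lemma fst_wordE v : fst_word v = pmap id (unzip1 v).
Proof. by elim: v => //= -[[a|] y] v /= ->. Qed.

Lemma snd_wordE v : snd_word v = pmap id (unzip2 v).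
Proof. by elim: v => //= -[x [a|]] v /= ->. Qed.

Lemma fst_word_take w1 w2 k : fst_word (take k (conv w1 w2)) = take k w1.
Proof.
rewrite fst_wordE /unzip1 map_take -/(unzip1 _).
have [i ->] := unzip1_conv w1 w2; exact: pmap_padded.
Qed.

Lemma snd_word_take w1 w2 k : snd_word (take k (conv w1 w2)) = take k w2.
Proof.
rewrite snd_wordE /unzip2 map_take -/(unzip2 _).
have [i ->] := unzip2_conv w1 w2; exact: pmap_padded.
Qed.

Lemma size_conv w1 w2 : size (conv w1 w2) = maxn (size w1) (size w2).
Proof. by rewrite size_mkseq. Qed.

Lemma fst_word_conv w1 w2 : fst_word (conv w1 w2) = w1.
Proof.
by rewrite -{1}(take_size (conv w1 w2)) fst_word_take size_conv take_oversize ?leq_maxl.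
Qed.

Lemma snd_word_conv w1 w2 : snd_word (conv w1 w2) = w2.
Proof.
by rewrite -{1}(take_size (conv w1 w2)) snd_word_take size_conv take_oversize ?leq_maxr.
Qed.

Definition both_ended (x : option A * option A) := ~~ isSome x.1 && ~~ isSome x.2.

Lemma eq_conv v w1 w2 i j :
  unzip1 v = map Some w1 ++ nseq i None -> unzip2 v = map Some w2 ++ nseq j None ->
  all (predC both_ended) v -> v = conv w1 w2.
Proof.
move=> E1 E2 nv.
have s1 : size v = size w1 + i.
  by rewrite -(size_map fst) -/(unzip1 v) E1 size_cat size_map size_nseq.
have s2 : size v = size w2 + j.
  by rewrite -(size_map snd) -/(unzip2 v) E2 size_cat size_map size_nseq.
have o1 w k l : nth None (map Some w ++ nseq l (@None A)) k = onth w k.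
  rewrite nth_cat size_map -onthE; case: ltnP => // lewk.
  by rewrite nth_nseq if_same onth_default.
(* If both tapes ended in padding, the last letter of [v] would be [both_ended]; so [i] or [j] is
   0. *)
have sv : size v = maxn (size w1) (size w2).
  case: i j E1 E2 s1 s2 => [|i] [|j] E1 E2; rewrite ?addn0 => s1 s2; try by lia.
  case: v E1 E2 nv s1 s2 => [|x v] E1 E2 nv s1 s2; first by rewrite addnS in s1.
  have := all_nthP (None, None) nv (size v) (ltnSn _).
  have -> : nth (None, None) (x :: v) (size v) =
            (nth None (unzip1 (x :: v)) (size v), nth None (unzip2 (x :: v)) (size v)).
    by rewrite !(nth_map (None, None)) //; case: (nth _ _ _).
  by rewrite E1 E2 !o1 !onth_default //; move: s1 s2 => /=; lia.
apply: (@eq_from_nth _ (None, None)); first by rewrite size_conv.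
move=> k ltk; rewrite nth_mkseq -?sv // -(o1 w1 k i) -(o1 w2 k j) -E1 -E2.
by rewrite !(nth_map (None, None)) //; case: (nth _ _ _).
Qed.

Lemma conv_not_both_ended w1 w2 : all (predC both_ended) (conv w1 w2).
Proof.
apply/(all_nthP (None, None)) => k; rewrite size_conv => ltk.
by rewrite nth_mkseq //= /both_ended !onthTE -!leqNgt -geq_max -ltnNge.
Qed.

Definition is_conv v : Prop := v = conv (fst_word v) (snd_word v).

Lemma is_convP v :
  is_conv v <-> [/\ padded (unzip1 v), padded (unzip2 v) & all (predC both_ended) v].
Proof.
split=> [->|[[w1 [i E1]] [w2 [j E2]] nv]].
  split; last exact: conv_not_both_ended.
    by have [i Ei] := unzip1_conv (fst_word v) (snd_word v); exists (fst_word v), i.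
  by have [i Ei] := unzip2_conv (fst_word v) (snd_word v); exists (snd_word v), i.
have E := eq_conv E1 E2 nv.
by rewrite /is_conv {2 3}E fst_word_conv snd_word_conv.
Qed.

Lemma paddedP (x : seq (option A)) :
  padded x <-> exists y z, [/\ all isSome y, all (predC isSome) z & x = y ++ z].
Proof.
split=> [[w [i ->]]|[u [v [Su Nv ->]]]].
  by exists (map Some w), (nseq i None); rewrite all_map all_predT all_nseq orbT.
exists (pmap id u), (size v); congr (_ ++ _).
  by elim: u Su => //= -[a|] y IH //= /IH <-.
by elim: v Nv => //= -[a|] y IH //= /IH <-.
Qed.

Lemma fin_index_padded : fin_index padded.
Proof.
apply: (fin_index_ext (L := fun x => exists y z,
  [/\ all isSome y, all (predC isSome) z & x = y ++ z])).
  by move=> x; apply: iff_sym; apply: paddedP.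
by apply: fin_index_cat; apply: fin_index_all.
Qed.

Lemma fin_index_is_conv : fin_index is_conv.
Proof.
apply: (fin_index_ext (L := fun v =>
  padded (unzip1 v) /\ padded (unzip2 v) /\ all (predC both_ended) v)).
  by move=> v; rewrite is_convP; split=> [[? []]|[]].
apply: fin_indexI; first exact: fin_index_map fin_index_padded.
apply: fin_indexI; first exact: fin_index_map fin_index_padded.
exact: fin_index_all.
Qed.

Definition conv_lang (R : seq A -> seq A -> Prop) v : Prop :=
  exists w1 w2, R w1 w2 /\ v = conv w1 w2.

(** A convolution determines its two words, so the alignment of [v] separates from the relation
    [R]. *)
Lemma conv_langE R v :
  conv_lang R v <-> is_conv v /\ R (fst_word v) (snd_word v).
Proof.
split=> [[w1 [w2 [Rw ->]]]|[cv Rv]]; last by exists (fst_word v), (snd_word v).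
by rewrite /is_conv fst_word_conv snd_word_conv.
Qed.

Definition balanced B v :=
  (size (fst_word v) <= size (snd_word v) + B) && (size (snd_word v) <= size (fst_word v) + B).

Lemma fst_word_cat u v : fst_word (u ++ v) = fst_word u ++ fst_word v.
Proof. exact: pmap_cat. Qed.

Lemma snd_word_cat u v : snd_word (u ++ v) = snd_word u ++ snd_word v.
Proof. exact: pmap_cat. Qed.

(* The longest prefix of s whose tapes have at most k letters either is s or fills one
   of the tapes, and then balance bounds what is left on the other. *)
Lemma balanced_cut B s k :
  (forall t r, s = t ++ r -> balanced B t) ->
  exists t r, s = t ++ r /\
    (exists b, take k (fst_word s) = fst_word t ++ b /\ size b <= B) /\
    (exists b, take k (snd_word s) = snd_word t ++ b /\ size b <= B).
Proof.
move=> balB.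
pose ok i := (size (fst_word (take i s)) <= k) && (size (snd_word (take i s)) <= k).
have ok0 : exists i, ok i && (i <= size s) by exists 0; rewrite /ok take0.
have leP i : ok i && (i <= size s) -> i <= size s by case/andP.
case: (ex_maxnP ok0 leP) => i /andP[/andP[ok1 ok2] les] maxi.
have bal := balB _ _ (esym (cat_take_drop i s)).
exists (take i s), (drop i s); split; first by rewrite cat_take_drop.
have E1 : fst_word s = fst_word (take i s) ++ fst_word (drop i s).
  by rewrite -fst_word_cat cat_take_drop.
have E2 : snd_word s = snd_word (take i s) ++ snd_word (drop i s).
  by rewrite -snd_word_cat cat_take_drop.
suff [m1 m2] : minn k (size (fst_word s)) <= size (fst_word (take i s)) + B /\
               minn k (size (snd_word s)) <= size (snd_word (take i s)) + B.
  have cut (w w1 w2 : seq A) : w = w1 ++ w2 -> size w1 <= k ->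
      minn k (size w) <= size w1 + B -> exists b, take k w = w1 ++ b /\ size b <= B.
    move=> -> le1 le2; exists (take (k - size w1) w2); split.
      by rewrite take_cat ltnNge le1.
    by move: le2; rewrite size_take_min size_cat; lia.
  by split; [apply: cut E1 _ _ | apply: cut E2 _ _].
have [Ei|lti] : i = size s \/ i < size s by lia.
  by rewrite Ei take_size; lia.
have nok : ~~ ok i.+1 by apply/negP => okS; have := maxi i.+1; rewrite okS lti ltnn => /(_ isT).
have [x0 _] : exists x : option A * option A, True by case: (s) lti => // x; exists x.
move: nok bal; rewrite /ok /balanced (take_nth x0) // -cats1 fst_word_cat snd_word_cat !size_cat.
move=> + /andP[]; case: (nth x0 _ i) => -[a|] [b|] /=; lia.
Qed.

End Convolution.

Lemma catI (T : Type) (s s1 s2 : seq T) : s ++ s1 = s ++ s2 -> s1 = s2.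
Proof. by elim: s => //= x s IH [] /IH. Qed.

(** A word of [P] may carry padding anywhere. After the aligned input [u], one remembers which
    triples occur: the class of a prefix [t] of an unaligned word, and the letters of [u] on each
    tape not yet produced by [t], at most [B] of them. *)
Lemma bounded_delay (A : finType) (P : seq (option A * option A) -> Prop) B :
  fin_index P -> (forall t r, P (t ++ r) -> balanced B t) ->
  fin_index (conv_lang (fun w1 w2 => exists s, [/\ P s, fst_word s = w1 & snd_word s = w2])).
Proof.
move=> [F [phi phiP]] balP.
have [G [psi psiP]] := fin_index_is_conv A.
pose left_over u (f : F * B.-bseq A * B.-bseq A) := exists t,
  [/\ phi t = f.1.1, fst_word u = fst_word t ++ f.1.2 & snd_word u = snd_word t ++ f.2].
exists (G * {set F * B.-bseq A * B.-bseq A})%type,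
  (fun u => (psi u, [set f | `[< left_over u f >]])).
move=> u v [uv1 /setP uv2] w.
rewrite !conv_langE => -[cuw [s [Ps Es1 Es2]]]; split; first exact: psiP uv1 _ cuw.
have [|t [r [Es [[b1 [Eb1 sb1]] [b2 [Eb2 sb2]]]]]] := @balanced_cut _ B s (size u).
  by move=> t r Es; apply: (balP t r); rewrite -Es.
(* In the convolution [u ++ w] padding comes only at the end of a tape, so [u] holds the first
   [size u] letters of each word. *)
have tk1 : take (size u) (fst_word s) = fst_word u.
  rewrite Es1 -(fst_word_take _ (snd_word (u ++ w))) -/(is_conv _) -cuw.
  by rewrite take_size_cat.
have tk2 : take (size u) (snd_word s) = snd_word u.
  by rewrite Es2 -(snd_word_take (fst_word (u ++ w))) -cuw take_size_cat.
have /asboolP : `[< left_over v (phi t, Bseq sb1, Bseq sb2) >].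
  have := uv2 (phi t, Bseq sb1, Bseq sb2); rewrite !inE => <-.
  by apply/asboolP; exists t; rewrite /= -tk1 -tk2.
(* The remainder [r] first produces the stored letters, which are the same for [t] and [t'], and
   then the tapes of [w]. *)
move=> [t' [/= tt' Ev1 Ev2]]; exists (t' ++ r); split.
- by apply: phiP (esym tt') _ _; rewrite -Es.
- rewrite !fst_word_cat Ev1 -catA; congr (_ ++ _).
  by apply: (@catI _ (fst_word t)); rewrite catA -Eb1 tk1 -!fst_word_cat -Es.
- rewrite !snd_word_cat Ev2 -catA; congr (_ ++ _).
  by apply: (@catI _ (snd_word t)); rewrite catA -Eb2 tk2 -!snd_word_cat -Es.
Qed.

(** * Pairs of words of bounded delay *)

Definition close (A : Type) B (u v : seq A) :=
  (size u <= size v + B) && (size v <= size u + B).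

Section Sync.
Variable A : finType.

(** The pairs of words are parametrised by data [d] such as integers or polynomials, so that
    relations can be imposed on the data and not on their encodings. *)
Definition sync (D : Type) (R : D -> Prop) (F G : D -> seq A) : Prop :=
  (exists B, forall d, R d -> close B (F d) (G d)) /\
  fin_index (fun w => exists d, R d /\ w = conv (F d) (G d)).

Lemma sync_ext (D D' : Type) (R : D -> Prop) (R' : D' -> Prop) F G F' G' :
  (forall d, R d -> exists d', [/\ R' d', F d = F' d' & G d = G' d']) ->
  (forall d', R' d' -> exists d, [/\ R d, F d = F' d' & G d = G' d']) ->
  sync R F G -> sync R' F' G'.
Proof.
move=> RR' R'R [[B clB] fiR]; split.
  by exists B => d' /R'R [d [/clB cl <- <-]].
apply: fin_index_ext fiR => w; split=> [[d [Rd ->]]|[d' [R'd' ->]]].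
  by have [d' [R'd' -> ->]] := RR' d Rd; exists d'.
by have [d [Rd <- <-]] := R'R d' R'd'; exists d.
Qed.

(** Gluing two convolutions leaves the padding of the first in the middle. Every prefix of the glued
    word is balanced up to [B1 + B2], so [bounded_delay] realigns it. *)
Lemma sync_cat (D1 D2 : Type) (R1 : D1 -> Prop) (R2 : D2 -> Prop) F1 G1 F2 G2 :
  sync R1 F1 G1 -> sync R2 F2 G2 ->
  sync (fun d => R1 d.1 /\ R2 d.2)
       (fun d => F1 d.1 ++ F2 d.2) (fun d => G1 d.1 ++ G2 d.2).
Proof.
move=> [[B1 cl1] fi1] [[B2 cl2] fi2]; split.
  exists (B1 + B2) => -[d1 d2] [/= /cl1 + /cl2].
  by rewrite /close !size_cat; lia.
have prefix_conv B (u v : seq A) t r : close B u v -> t ++ r = conv u v -> balanced B t.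
  move=> + E; have -> : t = take (size t) (conv u v) by rewrite -E take_size_cat.
  by rewrite /close /balanced fst_word_take snd_word_take !size_take_min; lia.
have bal t r : (exists u v, [/\ exists d, R1 d /\ u = conv (F1 d) (G1 d),
    exists d, R2 d /\ v = conv (F2 d) (G2 d) & t ++ r = u ++ v]) -> balanced (B1 + B2) t.
  move=> [u [v [[d1 [/cl1 c1 ->]] [d2 [/cl2 c2 ->]] E]]].
  have [[c [Et Ec]]|[c [Ec _]]] := cat_eq_cat E; last first.
    by have := prefix_conv _ _ _ _ _ c1 (esym Ec); rewrite /balanced; lia.
  have := prefix_conv _ _ _ _ _ c2 (esym Ec).
  rewrite Et /balanced fst_word_cat snd_word_cat !size_cat fst_word_conv snd_word_conv.
  by move: c1; rewrite /close; lia.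
apply: fin_index_ext (bounded_delay (fin_index_cat fi1 fi2) bal) => w; split.
  move=> [w1 [w2 [[s [[u [v [[d1 [R1d ->]] [d2 [R2d ->]] ->]]] <- <-]] ->]]].
  exists (d1, d2); split=> //=.
  by rewrite fst_word_cat snd_word_cat !fst_word_conv !snd_word_conv.
move=> [[d1 d2] [[/= R1d R2d] ->]].
eexists; eexists; split; last by [].
exists (conv (F1 d1) (G1 d1) ++ conv (F2 d2) (G2 d2)); split.
- by eexists; eexists; split; [exists d1 | exists d2 |].
- by rewrite fst_word_cat !fst_word_conv.
- by rewrite snd_word_cat !snd_word_conv.
Qed.

Lemma sync_word (u v : seq A) : sync (fun _ : unit => True) (fun=> u) (fun=> v).
Proof.
split; first by exists (size u + size v) => _ _; rewrite /close; lia.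
apply: fin_index_ext (fin_index_word (conv u v)) => w.
by split=> [->|[_ []]] //; exists tt.
Qed.

Lemma syncU (D : Type) (R R' : D -> Prop) F G :
  sync R F G -> sync R' F G -> sync (fun d => R d \/ R' d) F G.
Proof.
move=> [[B cl] fi] [[B' cl'] fi']; split.
  exists (B + B') => d [/cl|/cl']; rewrite /close; lia.
apply: fin_index_ext (fin_indexU fi fi') => w; split.
  by case=> [] [d [Rd ->]]; exists d; split=> //; [left|right].
by move=> [d [[Rd|Rd] ->]]; [left|right]; exists d.
Qed.

Lemma sync_ex (D : Type) (T : finType) (R : T -> D -> Prop) F G :
  (forall t, sync (R t) F G) -> sync (fun d => exists t, R t d) F G.
Proof.
move=> syR; suff : sync (fun d => exists2 t, t \in enum T & R t d) F G.
  by apply: sync_ext => d [t]; [move=> _|move=> Rd]; exists d;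
    split=> //; exists t; rewrite ?mem_enum.
elim: (enum T) => [|t s IH].
  split; first by exists 0 => d [].
  by exists unit, (fun=> tt) => u v _ w [d [[]]].
apply: sync_ext (syncU (syR t) IH) => d.
  case=> [Rd|[t' st' Rd]]; exists d; split=> //; first by exists t; rewrite ?mem_head.
  by exists t'; rewrite // inE st' orbT.
move=> [t']; rewrite inE => /orP[/eqP ->|st'] Rd; exists d; split=> //; first by left.
by right; exists t'.
Qed.

Lemma sync_nseq (a : A) : sync (fun _ : nat => True) (nseq^~ a) (nseq^~ a).
Proof.
split; first by exists 0 => k _; rewrite /close addn0 leqnn.
apply: fin_index_ext (fin_index_all (pred1 (Some a, Some a))) => w.
have convE k : conv (nseq k a) (nseq k a) = nseq k (Some a, Some a).
  apply/esym/(@eq_conv _ _ _ _ 0 0); rewrite /unzip1 /unzip2 ?cats0 ?map_nseq //.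
  by rewrite all_nseq orbT.
split=> [/all_pred1P ->|[k [_ ->]]]; first by exists (size w); rewrite convE.
by rewrite convE all_nseq /= eqxx orbT.
Qed.

Lemma sync_flatten (D : Type) (d0 : D) (I : eqType) (s : seq I) (R : I -> D -> Prop) F G :
  uniq s -> (forall i, sync (R i) (F i) (G i)) ->
  sync (fun d : I -> D => forall i, i \in s -> R i (d i))
    (fun d => flatten [seq F i (d i) | i <- s]) (fun d => flatten [seq G i (d i) | i <- s]).
Proof.
move=> + syR; elim: s => [_|i s IH /= /andP[nis /IH {}IH]].
  apply: sync_ext (sync_word [::] [::]) => d _; last by exists tt.
  by exists (fun=> d0).
apply: sync_ext (sync_cat (syR i) IH) => [[di d] /= [Ri Rs]|d Rd].
  (* As [s] does not contain [i], overwriting the value at [i] leaves its blocks unchanged. *)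
  pose d' j := if j == i then di else d j; exists d'.
  have Ed (H : I -> D -> seq A) :
      flatten [seq H j (d' j) | j <- s] = flatten [seq H j (d j) | j <- s].
    congr flatten; apply/eq_in_map => j js; rewrite /d'.
    by case: eqP => // ji; rewrite -ji js in nis.
  split; rewrite ?Ed /d' ?eqxx // => j; rewrite inE.
  by case: eqP => [->|_ /Rs].
exists (d i, d); split=> //; split; first by apply: Rd; rewrite mem_head.
by move=> j js; apply: Rd; rewrite inE js orbT.
Qed.

End Sync.

(** * Single blocks: powers and coefficient strings *)

Section Blocks.
Variable q : nat.
Local Notation Z := 'Z_q.

Definition power_word (m : int) : seq (letter q) :=
  nseq `|m|%N (if (0 <= m)%R then LX q else LY q).

Lemma sync_power_word (e : int) : `|e|%N <= 1 ->
  sync (fun _ : int => True) power_word (fun m => power_word (m + e)%R).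
Proof.
move=> le_e1.
have S (a : letter q) u v := sync_cat (sync_nseq a) (sync_word u v).
have {S} S (a : letter q) i j :
    sync (fun _ => True) (fun k => nseq (k + i) a) (fun k => nseq (k + j) a).
  apply: sync_ext (S a (nseq i a) (nseq j a)) => [[k []] _|k _].
    by exists k; rewrite /= -!nseqD.
  by exists (k, tt); rewrite /= -!nseqD.
have pwP k : power_word k%:Z = nseq k (LX q) by rewrite /power_word; congr nseq; lia.
have pwN k : power_word (- k%:Z)%R = nseq k (LY q).
  by case: k => [|k] //; rewrite /power_word; congr nseq; lia.
have syP (i j : nat) : (i%:Z + e = j%:Z)%R ->
    sync (fun m : int => (i%:Z <= m)%R) power_word (fun m => power_word (m + e)%R).
  move=> ije; apply: sync_ext (S (LX q) i j) => [k _|m mi].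
    exists (Posz (k + i)); split; first lia.
      by rewrite pwP.
    by rewrite PoszD -addrA ije -PoszD pwP.
  exists `|(m - i%:Z)%R|%N; split=> //; rewrite -pwP; congr power_word; lia.
have syN (i j : nat) : (j%:Z + e = i%:Z)%R ->
    sync (fun m : int => (m <= - i%:Z)%R) power_word (fun m => power_word (m + e)%R).
  move=> ije; apply: sync_ext (S (LY q) i j) => [k _|m mi].
    exists (- Posz (k + i))%R; split; first lia.
      by rewrite pwN.
    by rewrite -pwN; congr power_word; lia.
  exists `|(m + i%:Z)%R|%N; split=> //; rewrite -pwN; congr power_word; lia.
(* [i] and [j] are the negative and positive parts of [e]. For [m >= i] both words are powers of x,
   for [m <= -j] both are powers of y, and these two ranges cover all integers. *)
pose i := if (e == -1)%R then 1 else 0; pose j := if (e == 1)%R then 1 else 0.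
have ei : (i%:Z + e = j%:Z)%R by rewrite /i /j; case: eqP => [->|] //; case: eqP => [->|]; lia.
apply: sync_ext (syncU (syP i j ei) (syN j i ei)) => m.
  by exists m.
by exists m; split=> //; move: ei; rewrite /i /j; case: eqP; case: eqP; lia.
Qed.

Definition is_coef (x : option (letter q)) := if x is Some (LC _) then true else false.

(** A coefficient list is a word of coefficients that does not end in 0; the fictitious initial
    letter [LC 1] admits the empty list, which is the zero polynomial. *)
Lemma coef_wordP (x : seq (option (letter q))) :
  (exists c : {poly Z}, x = map Some (map (@LC q) c)) <->
  path (fun _ y => is_coef y) (Some (LC 1%R)) (map id x) &&
    (last (Some (LC 1%R)) (map id x) != Some (LC 0%R)).
Proof.
rewrite map_id; split.
  move=> [c ->]; apply/andP; split.
    by rewrite -map_comp; elim: (polyseq c) (Some _) => //= a s IH o; apply: IH.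
  rewrite -map_comp last_map; case: c => s /= nz; apply/eqP => -[] /eqP.
  exact/negP.
move=> /andP[px lx].
have [s Es] : exists s, x = map Some (map (@LC q) s).
  elim: x (Some _) px {lx} => [|[[|||c]|] x IH] o //=; first by exists [::].
  by move=> /IH [s ->]; exists (c :: s).
have nz : last 1%R s != 0%R.
  by apply: contraNneq lx; rewrite Es -map_comp last_map => ->.
by exists (Polynomial nz).
Qed.

Lemma fin_index_coef_padded :
  fin_index (fun x => exists (c : {poly Z}) i, x = map Some (map (@LC q) c) ++ nseq i None).
Proof.
pose e : rel (option (letter q)) := fun _ y => is_coef y.
have fi := fin_index_path id e (Some (LC 1%R)) (predC1 (Some (LC 0%R))).
apply: fin_index_ext (fin_index_cat fi (fin_index_all (pred1 None))) => x; split.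
  move=> [u [v [/coef_wordP [c ->] /all_pred1P -> ->]]].
  by exists c, (size v).
move=> [c [i ->]]; do 2!eexists; split; last by [].
  by apply/coef_wordP; exists c.
by rewrite all_nseq /= eqxx orbT.
Qed.

Definition coef_val (x : option (letter q)) : Z := if x is Some (LC c) then c else 0%R.

Definition coef_pair (d : {poly Z} * {poly Z}) k : Z * Z := (d.1`_k, d.2`_k)%R.

(** The state [None] marks the start, where [I] is tested. Past the end of [z] all entries are [x0],
    and [E x0 x0] holds, so only the step from the last entry to [x0] remains to be checked. *)
Lemma chainP (T : eqType) (I : pred T) (E : rel T) (x0 : T) (z : seq T) : E x0 x0 ->
  (path (fun o o' => if o' is Some y then (if o is Some x then E x y else I y) else false)
     None (map Some z) &&
   (if last None (map Some z) is Some x then E x x0 else I x0)) <->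
  (I (nth x0 z 0) /\ forall k, E (nth x0 z k) (nth x0 z k.+1)).
Proof.
move=> E00; case: z => [|x z] /=; first by split=> [->|[]//]; split=> // k; rewrite !nth_nil.
rewrite last_map -andbA.
have -> (e' : rel (option T)) : path e' (Some x) (map Some z) = path (relpre Some e') x z.
  by rewrite path_map.
have -> : path (relpre Some (fun o o' : option T => if o' is Some y then
   (if o is Some x then E x y else I y) else false)) x z = path E x z by [].
split=> [/and3P[Ix /(pathP x0) pz lz]|[Ix Ek]].
  split=> // k; have [ltk|gtk|->] := ltngtP k (size z); first exact: pz.
    by rewrite !nth_default //=; lia.
  by rewrite [X in E _ X]nth_default // nth_last.
rewrite Ix /=; apply/andP; split; first by apply/(pathP x0).
have := Ek (size z); rewrite [X in E _ X]nth_default //.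
by rewrite -[size z]/(size (x :: z)).-1 nth_last.
Qed.

(** Padding is read as the coefficient 0, in accordance with the vanishing of coefficients beyond
    the size. The convolution thus lists the coefficient pairs in order, and a condition on
    neighbouring pairs is a path condition. *)
Lemma sync_poly (B : nat) (R : {poly Z} * {poly Z} -> Prop) (I : pred (Z * Z)) (E : rel (Z * Z)) :
  E (0, 0)%R (0, 0)%R ->
  (forall d, R d <-> I (coef_pair d 0) /\ forall k, E (coef_pair d k) (coef_pair d k.+1)) ->
  (forall d, R d -> close B d.1 d.2) ->
  sync R (fun d => map (@LC q) d.1) (fun d => map (@LC q) d.2).
Proof.
move=> E00 RE clR; split; first by exists B => d /clR; rewrite /close !size_map.
pose val2 (x : option (letter q) * option (letter q)) := (coef_val x.1, coef_val x.2).
pose e (o o' : option (Z * Z)) :=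
  if o' is Some y then (if o is Some x then E x y else I y) else false.
pose f (o : option (Z * Z)) := if o is Some x then E x (0, 0)%R else I (0, 0)%R.
have fi1 := fin_index_map (@fst _ (option (letter q))) fin_index_coef_padded.
have fi2 := fin_index_map (@snd (option (letter q)) _) fin_index_coef_padded.
have fi := fin_index_path (fun x => Some (val2 x)) e None f.
have fib := @fin_index_all (option (letter q) * option (letter q)) (predC (@both_ended _)).
have val_conv (d : {poly Z} * {poly Z}) k :
    nth (0, 0)%R (map val2 (conv (map (@LC q) d.1) (map (@LC q) d.2))) k = coef_pair d k.
  have ov (c : {poly Z}) : coef_val (onth (map (@LC q) c) k) = (c`_k)%R.
    by rewrite onth_map -(odflt_onth 0%R); case: onth.
  have [ltk|gek] := ltnP k (size (conv (map (@LC q) d.1) (map (@LC q) d.2))).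
    rewrite (nth_map (None, None)) //; rewrite size_conv in ltk.
    by rewrite nth_mkseq // /val2 /= !ov.
  rewrite nth_default; last by rewrite size_map.
  rewrite /coef_pair.
  by move: gek; rewrite size_conv !size_map geq_max => /andP[? ?]; rewrite !nth_default.
apply: fin_index_ext (fin_indexI fi1 (fin_indexI fi2 (fin_indexI fib fi))) => v.
rewrite map_comp (chainP _ _ E00); split.
  move=> [[c1 [i1 E1]] [[c2 [i2 E2]] [nv ch]]].
  have Ev := eq_conv E1 E2 nv.
  exists (c1, c2); split=> //; apply/RE.
  case: ch; rewrite Ev (val_conv (c1, c2)) => I0 Ek; split=> // k.
  by have := Ek k; rewrite !(val_conv (c1, c2)).
move=> [d [/RE Rd ->]]; split; last split; last split.
- by have [i Ei] := unzip1_conv (map (@LC q) d.1) (map (@LC q) d.2); exists d.1, i.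
- by have [i Ei] := unzip2_conv (map (@LC q) d.1) (map (@LC q) d.2); exists d.2, i.
- exact: conv_not_both_ended.
- by split=> [|k]; rewrite !val_conv; apply Rd.
Qed.
End Blocks.

(** * Partial fractions *)

Local Open Scope ring_scope.

Section PartialFractions.
Variables (q n : nat) (l : 'I_n -> 'Z_q).
Local Notation Z := 'Z_q.
Local Notation lin := (lin l).

Lemma lin_monic k : lin k \is monic.
Proof. exact: monicXaddC. Qed.

Lemma prod_lin_monic (P : pred 'I_n) (N : 'I_n -> nat) :
  \prod_(k | P k) lin k ^+ N k \is monic.
Proof. by apply: monic_prod => k _; apply: monic_exp; apply: lin_monic. Qed.

Lemma monic_mulIr (p x y : {poly Z}) : p \is monic -> x * p = y * p -> x = y.
Proof. by move=> /monic_rreg pr /pr. Qed.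

(* The numerator of [f] over [\prod_k lin k ^ N k]; the junk value of [posn] on negative
   integers makes it meaningless unless [clears N f]. *)
Definition num (N : 'I_n -> int) (f : Defs.frac q n) : {poly Z} :=
  f.1 * \prod_(k < n) lin k ^+ posn (f.2 k + N k).

Definition clears (N : 'I_n -> int) (f : Defs.frac q n) := forall k, 0 <= f.2 k + N k.

Lemma posnE (x : int) : posn x = (if (0 <= x)%R then `|x| else 0)%N.
Proof. by case: x. Qed.

Lemma posn_shift (x y z : int) : 0 <= x + z -> 0 <= y + z ->
  posn (x + z) = (posn (x - y) + posn (Order.min x y + z))%N.
Proof. by move=> xz yz; rewrite !posnE /Order.min; do !case: ifP; lia. Qed.

(** Each numerator is a side of the cross-multiplied equation times the same product [M], which
    cancels because it is monic, even when ['Z_q] has zero divisors. *)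
Lemma frac_eq_num N f g : clears N f -> clears N g ->
  frac_eq l f g <-> num N f = num N g.
Proof.
move=> fN gN; rewrite /num /frac_eq.
pose M := \prod_(k < n) lin k ^+ posn (Order.min (f.2 k) (g.2 k) + N k).
have -> : \prod_(k < n) lin k ^+ posn (f.2 k + N k) =
          \prod_(k < n) lin k ^+ posn (f.2 k - g.2 k) * M.
  by rewrite -big_split; apply: eq_bigr => k _ /=; rewrite -exprD -posn_shift.
have -> : \prod_(k < n) lin k ^+ posn (g.2 k + N k) =
          \prod_(k < n) lin k ^+ posn (g.2 k - f.2 k) * M.
  rewrite -big_split; apply: eq_bigr => k _ /=; rewrite -exprD.
  by rewrite [Order.min (f.2 k) _]minC -posn_shift.
by rewrite !mulrA; split=> [->|/monic_mulIr -> //]; rewrite ?prod_lin_monic.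
Qed.

Lemma clears_add N f g : clears N f -> clears N g -> clears N (frac_add l f g).
Proof. by move=> fN gN k; rewrite ffunE /Order.min; case: ifP. Qed.

Lemma num_add N f g : clears N f -> clears N g ->
  num N (frac_add l f g) = num N f + num N g.
Proof.
move=> fN gN; rewrite /num /= mulrDl -!mulrA; congr (_ * _ + _ * _).
  rewrite -big_split; apply: eq_bigr => k _ /=.
  by rewrite ffunE -exprD -posn_shift.
rewrite -big_split; apply: eq_bigr => k _ /=.
by rewrite ffunE -exprD minC -posn_shift.
Qed.

Lemma eq_num N N' f : N =1 N' -> num N f = num N' f.
Proof. by move=> E; rewrite /num; under eq_bigr do rewrite E. Qed.

Lemma num_shift N m f : num N (frac_shift m f) = num (fun k => N k + m k) f.
Proof.
by rewrite /num; congr (_ * _); apply: eq_bigr => k _; rewrite ffunE addrAC -addrA.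
Qed.

Lemma num_lin N i f : clears N f ->
  lin i * num N f = num (fun k => N k + (k == i)%:Z) f.
Proof.
move=> fN; rewrite /num mulrCA; congr (_ * _).
rewrite (bigD1 i) //= [RHS](bigD1 i) //= mulrA eqxx -exprS; congr (_ ^+ _ * _).
  by have := fN i; rewrite !posnE; do !case: ifP; lia.
by apply: eq_bigr => k /negPf ->; rewrite addr0.
Qed.

(* Numerators over [lin k ^+ N] and over the common denominator [\prod_k lin k ^+ N]. *)
Definition tail_num N k (x : {poly Z}) : {poly Z} :=
  \sum_(a < N) (x`_a)%:P * lin k ^+ (N - a.+1).

Definition pf_num N (c : 'I_n -> {poly Z}) (cd : {poly Z}) : {poly Z} :=
  \sum_(k < n) tail_num N k (c k) * \prod_(k' < n | k' != k) lin k' ^+ N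
  + cd * \prod_(k < n) lin k ^+ N.

Lemma num_place N k (x : {poly Z}) : (size x <= N)%N ->
  num (fun=> N%:Z) (frac_place l k x) =
  tail_num N k x * \prod_(k' < n | k' != k) lin k' ^+ N.
Proof.
move=> lexN; rewrite /num /= (bigD1 k) //= mulrA; congr (_ * _); last first.
  by apply: eq_bigr => j /negPf jk; rewrite ffunE jk mul0n oppr0 add0r.
rewrite ffunE eqxx mul1n addrC subzn //= mulr_suml /tail_num.
rewrite (big_ord_widen_cond N predT
  (fun a => (x`_a)%:P * lin k ^+ (size x - a.+1) * lin k ^+ (N - size x))) //.
rewrite big_mkcond; apply: eq_bigr => a _ /=.
case: ltnP => [lta|gea]; last by rewrite nth_default // mul0r.
by rewrite -mulrA -exprD addnC addnBA // subnK.
Qed.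

Lemma num_decomp_sum N (c : 'I_n -> {poly Z}) cd : (forall k, size (c k) <= N)%N ->
  clears (fun=> N%:Z) (decomp_sum l c cd) /\
  num (fun=> N%:Z) (decomp_sum l c cd) = pf_num N c cd.
Proof.
move=> lecN; pose z : Defs.frac q n := (cd, [ffun=> 0]).
have zN : clears (fun=> N%:Z) z by move=> k; rewrite ffunE add0r.
have plN k : clears (fun=> N%:Z) (frac_place l k (c k)).
  by move=> j; rewrite ffunE; have := lecN k; case: (j == k); lia.
suff IH s : clears (fun=> N%:Z) (foldr (frac_add l) z [seq frac_place l k (c k) | k <- s]) /\
    num (fun=> N%:Z) (foldr (frac_add l) z [seq frac_place l k (c k) | k <- s]) =
    \sum_(k <- s) tail_num N k (c k) * \prod_(k' < n | k' != k) lin k' ^+ N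
      + cd * \prod_(k < n) lin k ^+ N.
  by rewrite /pf_num -[X in X + _]big_enum; apply: IH.
elim: s => [|k s [clN IH]] /=.
  rewrite big_nil add0r; split=> //; rewrite /num; congr (_ * _).
  by apply: eq_bigr => k _; rewrite ffunE add0r.
split; first exact: clears_add.
by rewrite num_add // IH num_place // big_cons addrA.
Qed.

(** Multiplication by [lam *: 'X + mu%:P], written as [lam] times [t + l k] plus the constant
    [mu - lam * l k], acting on a tail in negative powers of [t + l k]. The factor [t + l k] shifts
    the coefficients by one and expels the first as a constant. *)
Definition pf_step (lam mu : Z) k (x : {poly Z}) : {poly Z} :=
  lam *: drop_poly 1 x + (mu - lam * l k) *: x.

Lemma tail_num_step N lam mu k (x : {poly Z}) : (size x <= N)%N ->
  (lam *: 'X + mu%:P) * tail_num N k x =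
  tail_num N k (pf_step lam mu k x) + (lam * x`_0)%:P * lin k ^+ N.
Proof.
move=> lexN.
have tailD y z a b : tail_num N k (a *: y + b *: z) = a%:P * tail_num N k y + b%:P * tail_num N k z.
  rewrite /tail_num !mulr_sumr -big_split; apply: eq_bigr => j _ /=.
  by rewrite coefD !coefZ polyCD !polyCM mulrDl !mulrA.
have tailX : lin k * tail_num N k x = tail_num N k (drop_poly 1 x) + (x`_0)%:P * lin k ^+ N.
  rewrite /tail_num mulr_sumr.
  transitivity (\sum_(a < N) (x`_a)%:P * lin k ^+ (N - a)).
    apply: eq_bigr => a _; rewrite mulrCA -exprS; congr (_ * _ ^+ _).
    by have := ltn_ord a; lia.
  case: N lexN {tailD} => [|N] lexN.
    by rewrite !big_ord0 nth_default // mul0r addr0.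
  rewrite big_ord_recl subn0 addrC; congr (_ + _).
  rewrite big_ord_recr /= coef_drop_poly nth_default ?addn1 // mul0r addr0.
  by apply: eq_bigr => a _; rewrite coef_drop_poly addn1.
rewrite /pf_step tailD.
have -> : lam *: 'X + mu%:P = lam%:P * lin k + (mu - lam * l k)%:P.
  by rewrite /Defs.lin polyCB polyCM -mul_polyC; ring.
by rewrite mulrDl -mulrA tailX polyCM; ring.
Qed.

(** The constants expelled from the tails are collected in the polynomial part. *)
Lemma pf_num_step N lam mu (c : 'I_n -> {poly Z}) cd : (forall k, size (c k) <= N)%N ->
  (lam *: 'X + mu%:P) * pf_num N c cd =
  pf_num N (fun k => pf_step lam mu k (c k))
    ((lam *: 'X + mu%:P) * cd + (lam * \sum_(k < n) (c k)`_0)%:P).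
Proof.
move=> lecN; rewrite /pf_num mulrDr mulr_sumr [in RHS]mulrDl [in RHS]addrCA -!mulrA addrC.
congr (_ + _); rewrite mulr_sumr rmorph_sum mulr_suml -big_split /=.
apply: eq_bigr => k _; rewrite mulrA tail_num_step // mulrDl; congr (_ + _).
by rewrite [in RHS](bigD1 k) //= mulrA.
Qed.

Lemma pf_numB N c c' cd cd' :
  pf_num N c cd - pf_num N c' cd' = pf_num N (fun k => c k - c' k) (cd - cd').
Proof.
rewrite /pf_num mulrBl opprD addrACA -sumrB; congr (_ + _).
apply: eq_bigr => k _; rewrite -mulrBl; congr (_ * _).
rewrite /tail_num -sumrB; apply: eq_bigr => a _.
by rewrite -mulrBl coefB polyCB.
Qed.

Hypothesis l_unit : forall i j, i != j -> l i - l j \is a GRing.unit.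

(* Translating by [- l k] turns [lin k] into ['X] and every other [lin k'] into a
   polynomial with invertible constant term. *)
Lemma pf_num_eq0 N (c : 'I_n -> {poly Z}) cd : (forall k, size (c k) <= N)%N ->
  pf_num N c cd = 0 -> (forall k, c k = 0) /\ cd = 0.
Proof.
move=> lecN V0.
have c0 k : c k = 0.
  pose X := 'X - (l k)%:P.
  pose T := tail_num N k (c k) \Po X.
  pose P := (\prod_(k' < n | k' != k) lin k' ^+ N) \Po X.
  have linX j : lin j \Po X = 'X + (l j - l k)%:P.
    by rewrite /Defs.lin rmorphD /= comp_polyX comp_polyC /X polyCB; ring.
  have linkX : lin k \Po X = 'X by rewrite linX subrr polyC0 addr0.
  have TE : T = \sum_(a < N) (c k)`_a *: 'X^(N - a.+1).
    rewrite /T rmorph_sum /=; apply: eq_bigr => a _.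
    by rewrite rmorphM rmorphXn /= comp_polyC linkX mul_polyC.
  (* All other summands contain [lin k ^+ N], which becomes ['X^N] after the translation. *)
  have [W EW] : exists W, T * P = W * 'X^N.
    pose W0 := \sum_(j < n | j != k) tail_num N j (c j) *
       \prod_(k' < n | (k' != j) && (k' != k)) lin k' ^+ N
       + cd * \prod_(k' < n | k' != k) lin k' ^+ N.
    exists (- (W0 \Po X)).
    have : tail_num N k (c k) * (\prod_(k' < n | k' != k) lin k' ^+ N) + W0 * lin k ^+ N = 0.
      rewrite -[RHS]V0 /pf_num [in RHS](bigD1 k) //= -[in RHS]addrA; congr (_ + _).
      rewrite mulrDl mulr_suml; congr (_ + _); last first.
        by rewrite -mulrA [in RHS](bigD1 k) //= (mulrC (lin k ^+ N)).
      apply: eq_bigr => j jk; rewrite -mulrA; congr (_ * _).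
      by rewrite [in RHS](bigD1 k) 1?eq_sym //= [RHS]mulrC.
    move=> /(congr1 (fun p => p \Po X)); rewrite rmorphD !rmorphM rmorphXn rmorph0 /=.
    by rewrite linkX -/T -/P mulNr => /eqP; rewrite addr_eq0 => /eqP.
  have P0 : P`_0 \is a GRing.unit.
    rewrite -horner_coef0 /P rmorph_prod /= horner_prod.
    apply: rpred_prod => j jk; rewrite rmorphXn /= horner_exp linX hornerD hornerX hornerC add0r.
    by rewrite unitrX // l_unit.
  (* The coefficient of degree [i] of [T * P] is [T_i * P_0] once the lower coefficients of [T]
     vanish, and [P_0] is a unit. *)
  have T0 i : (i < N)%N -> T`_i = 0.
    elim/ltn_ind: i => i IH ltiN.
    have := congr1 (fun p : {poly Z} => p`_i) EW; rewrite coefMXn ltiN coefM big_ord_recr /=.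
    rewrite subnn big1 ?add0r => [/eqP|j _]; last by rewrite IH ?mul0r //; have := ltn_ord j; lia.
    by rewrite (mulIr_eq0 _ (mulIr P0)) => /eqP.
  apply/polyP => a; rewrite coef0.
  have [ltaN|leNa] := ltnP a N; last by rewrite nth_default // (leq_trans (lecN k)).
  rewrite -[RHS](T0 (N - a.+1)%N); last by lia.
  rewrite TE coef_sum (bigD1 (Ordinal ltaN)) //= coefZ coefXn eqxx mulr1 big1 ?addr0 //.
  move=> b ba; rewrite coefZ coefXn; case: eqP; rewrite ?mulr0 // => E.
  by case/eqP: ba; apply: val_inj => /=; have := ltn_ord b; lia.
split=> //; move: V0; rewrite /pf_num big1 ?add0r => [V0|k _].
  apply: (monic_mulIr (prod_lin_monic predT (fun=> N))).
  by rewrite mul0r.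
by rewrite /tail_num big1 ?mul0r // => a _; rewrite c0 coef0 mul0r.
Qed.

Lemma pf_num_inj N (c c' : 'I_n -> {poly Z}) cd cd' :
  (forall k, size (c k) <= N)%N -> (forall k, size (c' k) <= N)%N ->
  pf_num N c cd = pf_num N c' cd' <-> (forall k, c k = c' k) /\ cd = cd'.
Proof.
move=> lecN lec'N; split=> [/eqP|[cE ->]].
  rewrite -subr_eq0 pf_numB => /eqP /pf_num_eq0 [|c0 /eqP].
    by move=> k; rewrite (leq_trans (size_polyD _ _)) // size_polyN geq_max lecN lec'N.
  by rewrite subr_eq0 => /eqP ->; split=> // k; apply/eqP; rewrite -subr_eq0 c0.
by rewrite /pf_num; congr (_ + _); apply: eq_bigr => k _; rewrite cE.
Qed.

Lemma size_pf_step lam mu k x : (size (pf_step lam mu k x) <= size x)%N.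
Proof.
rewrite (leq_trans (size_polyD _ _)) // geq_max !(leq_trans (size_scale_leq _ _)) //.
by rewrite size_drop_poly leq_subr.
Qed.

(* The factor [lam *: 'X + mu%:P] is [1] for type 1 generators and [lin j] for type 2. *)
Definition pf_rel (i : 'I_n) (b lam mu : Z) (c : 'I_n -> {poly Z}) cd (c' : 'I_n -> {poly Z}) cd' :=
  (forall k, pf_step 1 (l i) k (c' k) = pf_step lam mu k (c k)) /\
  ('X + (l i)%:P) * cd' + (\sum_(k < n) (c' k)`_0)%:P =
  (lam *: 'X + mu%:P) * cd + (lam * \sum_(k < n) (c k)`_0 + b)%:P.

(** The hypothesis is [u_i R'' = p R' + b] cleared of denominators, for all large [N] since [N] must
    also bound the lengths of the strings. Multiplication by the monic [lin i] is injective, and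
    after it both sides are partial fractions over one denominator, equal part by part by
    uniqueness. *)
Lemma frac_eq_step i b lam mu (f f' : Defs.frac q n) c cd c' cd' :
  (exists N0 : nat, forall N : nat, (N0 <= N)%N ->
     lin i * num (fun=> N%:Z) f' = (lam *: 'X + mu%:P) * num (fun=> N%:Z) f +
       b%:P * \prod_(k < n) lin k ^+ N) ->
  frac_eq l f (decomp_sum l c cd) ->
  frac_eq l f' (decomp_sum l c' cd') <-> pf_rel i b lam mu c cd c' cd'.
Proof.
move=> [N0 ff'] fc.
pose N := (N0 + \sum_k (size (c k) + size (c' k) + `|f.2 k| + `|f'.2 k|))%N.
have bN k : [/\ size (c k) <= N, size (c' k) <= N, `|f.2 k| <= N & `|f'.2 k| <= N]%N.
  by rewrite /N (bigD1 k) //=; split; lia.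
have lec k : (size (c k) <= N)%N by case: (bN k).
have lec' k : (size (c' k) <= N)%N by case: (bN k).
have fN : clears (fun=> N%:Z) f by move=> k; case: (bN k); lia.
have f'N : clears (fun=> N%:Z) f' by move=> k; case: (bN k); lia.
have [dN dE] := num_decomp_sum cd lec.
have [d'N d'E] := num_decomp_sum cd' lec'.
move/(frac_eq_num fN dN): fc; rewrite dE => fE.
rewrite (frac_eq_num f'N d'N) d'E.
have linE : lin i = 1 *: 'X + (l i)%:P by rewrite scale1r.
transitivity (lin i * num (fun=> N%:Z) f' = lin i * pf_num N c' cd').
  by split=> [->|/(monic_lreg (lin_monic i))].
rewrite ff' ?leq_addr // fE pf_num_step // linE pf_num_step // -linE.
have -> C D : pf_num N C D + b%:P * \prod_(k < n) lin k ^+ N = pf_num N C (D + b%:P).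
  by rewrite /pf_num mulrDl addrA.
rewrite pf_num_inj; last 2 first.
- by move=> k; apply: leq_trans (size_pf_step _ _ _ _) _.
- by move=> k; apply: leq_trans (size_pf_step _ _ _ _) _.
rewrite /pf_rel polyCD addrA mul1r; split=> -[H1 H2]; split=> // k; exact/esym.
Qed.

(** The entry of [gs] is that of [g] plus the entry of [s] times the power product of [g]; dividing
    by the power product of [gs] cancels the latter. *)
Lemma Rprime_gmul_num (g s : gelt q n) N :
  clears (fun k => N k - g.1 k - s.1 k) g.2 -> clears (fun k => N k - s.1 k) s.2 ->
  num N (Rprime (gmul l g s)) =
  num (fun k => N k - g.1 k - s.1 k) g.2 + num (fun k => N k - s.1 k) s.2.
Proof.
move=> gN sN; rewrite /Rprime num_shift /gmul /=.
have E k : N k + [ffun k => - [ffun k => g.1 k + s.1 k] k] k = N k - g.1 k - s.1 k.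
  by rewrite !ffunE opprD addrA.
have sN' : clears (fun k => N k - g.1 k - s.1 k) (frac_shift g.1 s.2).
  by move=> k; have := sN k; rewrite ffunE; lia.
rewrite (eq_num _ E) num_add // num_shift; congr (_ + _).
by apply: eq_num => k; rewrite -addrA addrCA addrC -!addrA; lia.
Qed.

End PartialFractions.

(** * Normal forms *)

Section NormalForms.
Variables (q n : nat).

(** Attaching each separator to the block behind it turns a joined word into a plain concatenation
    of independent blocks. *)
Definition sep (k : 'I_n) : seq (letter q) := if k == 0 :> nat then [::] else [:: LHash q].

Lemma hash_joinE (f : 'I_n -> seq (letter q)) :
  hash_join [seq f k | k <- enum 'I_n] = flatten [seq sep k ++ f k | k <- enum 'I_n].
Proof.
rewrite /sep; case: n f => [|n'] f; first by rewrite enum_ord0.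
by rewrite enum_ordSl /= -!map_comp.
Qed.

Lemma hash_join_rcons (ss : seq (seq (letter q))) x :
  ss != [::] -> hash_join (ss ++ [:: x]) = hash_join ss ++ LHash q :: x.
Proof.
case: ss => //= s ss _.
by rewrite map_cat flatten_cat /= cats0 catA.
Qed.

End NormalForms.

(** * Regularity from the relation between R' and R'' *)

Section Generators.
Variables (q n : nat) (l : 'I_n -> 'Z_q).
Hypothesis l_unit : forall i j, i != j -> l i - l j \is a GRing.unit.
Local Notation Z := 'Z_q.
Variables (i : 'I_n) (b lam mu : Z).
Hypothesis lam_mu : lam = 0 /\ mu = 1 \/ lam = 1 /\ exists j, mu = l j.

Lemma coef_pf_step la m k (x : {poly Z}) a :
  (pf_step l la m k x)`_a = la * x`_a.+1 + (m - la * l k) * x`_a.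
Proof. by rewrite coefD !coefZ coef_drop_poly addn1. Qed.

(** If [m - la * l k] is a unit, the top coefficient survives. Otherwise [m = l k], and the step is
    a pure shift, which removes one coefficient. *)
Lemma size_pf_step_ge la m k (x : {poly Z}) :
  la = 0 /\ m = 1 \/ la = 1 /\ (exists j, m = l j) ->
  (size x <= (size (pf_step l la m k x)).+1)%N.
Proof.
have unit_case : m - la * l k \is a GRing.unit -> (size x <= (size (pf_step l la m k x)).+1)%N.
  move=> u; case Ex: (size x) => [|a] //; rewrite ltnS leqNgt; apply/negP => lt_sz.
  have := coef_pf_step la m k x a.
  rewrite nth_default ?(ltnW lt_sz) // [x`_a.+1]nth_default ?Ex // mulr0 add0r => /esym/eqP.
  rewrite (mulrI_eq0 _ (mulrI u)) -[a]/(a.+1.-1) -Ex -lead_coefE lead_coef_eq0 => /eqP x0.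
  by rewrite x0 size_poly0 in Ex.
move=> [[la0 m1]|[la1 [j mj]]]; first by apply: unit_case; rewrite la0 m1 mul0r subr0 unitr1.
have [jk|jk] := eqVneq j k; last by apply: unit_case; rewrite mj la1 mul1r l_unit.
by rewrite /pf_step mj jk la1 mul1r subrr scale0r addr0 scale1r size_drop_poly; lia.
Qed.

Lemma close_pf_step k (x y : {poly Z}) :
  pf_step l 1 (l i) k y = pf_step l lam mu k x -> close 1 x y.
Proof.
move=> E; have := size_pf_step_ge k x lam_mu; rewrite -E.
have := size_pf_step_ge (la := 1) (m := l i) k y; rewrite E.
have := size_pf_step l lam mu k x; have := size_pf_step l 1 (l i) k y; rewrite E.
move=> sy sx /(_ (or_intror (conj erefl (ex_intro _ i erefl)))) sy' sx'.
by rewrite /close; lia.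
Qed.

Lemma size_linear (p x : {poly Z}) C : p \is monic -> (size p <= 2)%N ->
  (size x <= (size (p * x + C%:P)%R).+1)%N /\ (size (p * x + C%:P)%R <= (size x).+1)%N.
Proof.
move=> pm p2; have sC : (size (C%:P : {poly Z}) <= 1)%N by rewrite size_polyC leq_b1.
have p0 : (0 < size p)%N by rewrite lt0n size_poly_eq0 monic_neq0.
have [->|x0] := eqVneq x 0.
  by rewrite mulr0 add0r size_poly0; lia.
have spx : size (p * x) = (size p + size x).-1 by rewrite mulrC size_Mmonic // addnC.
split; last by rewrite (leq_trans (size_polyD _ _)) // geq_max; lia.
(* Once [x] has size at least 2, so has the product, and the constant cannot cancel its leading
   term. *)
have [x1|x1] := leqP (size x) 1; first by lia.
by rewrite size_polyDl; lia.
Qed.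

Definition factor : {poly Z} := lam *: 'X + mu%:P.

Lemma factor_monic : factor \is monic /\ (size factor <= 2)%N.
Proof.
rewrite /factor; case: lam_mu => [[-> ->]|[-> [j ->]]].
  by rewrite scale0r add0r monic1 size_poly1.
by rewrite scale1r monicXaddC size_XaddC.
Qed.

Lemma close_linear C C' (x y : {poly Z}) :
  ('X + (l i)%:P) * y + C'%:P = factor * x + C%:P -> close 2 x y.
Proof.
move=> E; have [fm f2] := factor_monic.
have [x1 x2] := size_linear x C fm f2.
have [y1 y2] := size_linear y C' (monicXaddC (l i)) (eq_leq (size_XaddC (l i))).
have aux (sx sy t t' : nat) : t' = t -> (sx <= t.+1 -> t <= sx.+1 ->
  sy <= t'.+1 -> t' <= sy.+1 -> (sx <= sy + 2) && (sy <= sx + 2))%N by lia.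
exact: aux (congr1 (fun p : {poly Z} => size p) E) x1 x2 y1 y2.
Qed.

(** The first coefficients are fixed to [v] because they enter the equation of the polynomial parts;
    this makes the blocks independent of each other. *)
Lemma sync_tail_block k (v : Z * Z) :
  sync (fun d : {poly Z} * {poly Z} =>
          pf_step l 1 (l i) k d.2 = pf_step l lam mu k d.1 /\ coef_pair d 0 = v)
    (fun d => sep q k ++ map (@LC q) d.1) (fun d => sep q k ++ map (@LC q) d.2).
Proof.
pose E (x y : Z * Z) := y.2 + (l i - l k) * x.2 == lam * y.1 + (mu - lam * l k) * x.1.
have S := @sync_poly q 1
  (fun d => pf_step l 1 (l i) k d.2 = pf_step l lam mu k d.1 /\ coef_pair d 0 = v)
  (pred1 v) E.
have {}S := sync_cat (sync_word (sep q k) (sep q k)) (S _ _ _).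
apply: sync_ext (S _ _ _) => [[t d] /= [_ dP]|d dP|||].
- by exists d.
- by exists (tt, d).
- by rewrite /E /= !mulr0.
- move=> d; split=> [[/polyP dE <-]|[/eqP d0 Ed]].
    split=> [|a]; first exact/eqP.
    by have := dE a; rewrite !coef_pf_step /E /= !mul1r => ->.
  split=> //; apply/polyP => a; rewrite !coef_pf_step !mul1r.
  exact/eqP/(Ed a).
- by move=> d [/close_pf_step].
Qed.

Lemma sync_poly_block (C C' : Z) :
  sync (fun d : {poly Z} * {poly Z} =>
          ('X + (l i)%:P) * d.2 + C'%:P = factor * d.1 + C%:P)
    (fun d => LHash q :: map (@LC q) d.1) (fun d => LHash q :: map (@LC q) d.2).
Proof.
(* [I] compares the constant coefficients of the two sides, [E] those of degree [a.+1]. *)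
pose I (x : Z * Z) := l i * x.2 + C' == mu * x.1 + C.
pose E (x y : Z * Z) := x.2 + l i * y.2 == lam * x.1 + mu * y.1.
have S := @sync_poly q 2 (fun d => ('X + (l i)%:P) * d.2 + C'%:P = factor * d.1 + C%:P) I E.
have {}S := sync_cat (sync_word [:: LHash q] [:: LHash q]) (S _ _ _).
have coef0 (u w : Z) (x : {poly Z}) K : ((u *: 'X + w%:P) * x + K%:P)`_0 = w * x`_0 + K.
  by rewrite mulrDl -scalerAl !coefD coefZ coefXM coefCM coefC mulr0 add0r.
have coefS (u w : Z) (x : {poly Z}) K a :
    ((u *: 'X + w%:P) * x + K%:P)`_a.+1 = u * x`_a + w * x`_a.+1.
  by rewrite mulrDl -scalerAl !coefD coefZ coefXM coefCM coefC addr0.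
have XE : 'X + (l i)%:P = 1 *: 'X + (l i)%:P by rewrite scale1r.
apply: sync_ext (S _ _ _) => [[t d] /= [_ dP]|d dP|||].
- by exists d.
- by exists (tt, d).
- by rewrite /E /= !mulr0.
- move=> d; rewrite XE; split=> [/polyP dE|[/eqP d0 Ed]].
    split=> [|a]; first by have := dE 0%N; rewrite !coef0 /I /= => ->.
    by have := dE a.+1; rewrite !coefS mul1r /E /= => ->.
  apply/polyP => -[|a]; rewrite ?coef0 ?coefS ?mul1r //.
  exact/eqP/(Ed a).
- by move=> d /close_linear.
Qed.

Lemma sync_prefix_block (e : int) (k : 'I_n) : (`|e| <= 1)%N ->
  sync (fun _ : int => True) (fun m => sep q k ++ power_word q m)
    (fun m => sep q k ++ power_word q (m + e)).
Proof.
move=> /(sync_power_word q) S.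
apply: sync_ext (sync_cat (sync_word (sep q k) (sep q k)) S) => [[t d] _|d _].
  by exists d.
by exists (tt, d).
Qed.

Variables (s : gelt q n).
Hypothesis s_small : forall k, (`|s.1 k| <= 1)%N.
Hypothesis s_step : forall g : gelt q n, exists N0 : nat, forall N : nat, (N0 <= N)%N ->
  lin l i * num l (fun=> N%:Z) (Rprime (gmul l g s)) =
  factor * num l (fun=> N%:Z) (Rprime g) + b%:P * \prod_(k < n) lin l k ^+ N.

Definition nf_word (m : {ffun 'I_n -> int}) (c : 'I_n -> {poly Z}) (cd : {poly Z}) :=
  nf_prefix q m ++ nf_suffix c cd.

Lemma nf_wordE m (c : 'I_n -> {poly Z}) (cd : {poly Z}) :
  nf_word m c cd =
  flatten [seq sep q k ++ power_word q (m k) | k <- enum 'I_n] ++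
  flatten [seq sep q k ++ map (@LC q) (c k) | k <- enum 'I_n] ++
  LHash q :: map (@LC q) cd.
Proof.
rewrite /nf_word /nf_prefix /nf_suffix hash_join_rcons.
  by rewrite !hash_joinE.
(* The index [i] witnesses that there is at least one tail, hence a separator before the polynomial
   part. *)
by rewrite -size_eq0 size_map size_enum_ord -lt0n (leq_ltn_trans _ (ltn_ord i)).
Qed.

Lemma langP w : lang l s w <->
  exists m c cd c' cd', pf_rel l i b lam mu c cd c' cd' /\
    w = conv (nf_word m c cd) (nf_word [ffun k => m k + s.1 k] c' cd').
Proof.
split.
  move=> [g [w1 [w2 [[c [cd [gE ->]]] [[c' [cd' [gsE ->]]] ->]]]]].
  exists g.1, c, cd, c', cd'; split=> //.
  exact/(frac_eq_step l_unit _ _ (s_step g) gE).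
move=> [m [c [cd [c' [cd' [rel ->]]]]]].
(* Any exponents and partial fractions arise from a group element: multiply the sum by the power
   product to get the matrix entry. *)
pose g : gelt q n := (m, frac_shift m (decomp_sum l c cd)).
have gE : frac_eq l (Rprime g) (decomp_sum l c cd).
  rewrite /frac_eq /Rprime /=; congr (_ * _); apply: eq_bigr => k _.
  by rewrite !ffunE addrK.
exists g, (nf_word m c cd), (nf_word [ffun k => m k + s.1 k] c' cd').
split; first by exists c, cd.
split=> //; exists c', cd'; split=> //.
exact/(frac_eq_step l_unit _ _ (s_step g) gE).
Qed.

Lemma lang_regular : regular (lang l s).
Proof.
apply: fin_index_regular.
pose D : Type := (('I_n -> int) * (('I_n -> {poly Z} * {poly Z}) * ({poly Z} * {poly Z})))%type.
(* [v] guesses the first coefficients of all tails. For each of the finitely many [v], the condition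
   splits into one on the powers, one on each tail and one on the polynomial parts. *)
pose R (v : {ffun 'I_n -> Z * Z}) (d : D) :=
  (forall k, k \in enum 'I_n -> True) /\
  (forall k, k \in enum 'I_n ->
     pf_step l 1 (l i) k (d.2.1 k).2 = pf_step l lam mu k (d.2.1 k).1 /\
     coef_pair (d.2.1 k) 0 = v k) /\
  ('X + (l i)%:P) * d.2.2.2 + (\sum_k (v k).2)%:P =
    factor * d.2.2.1 + (lam * \sum_k (v k).1 + b)%:P.
have [] := @sync_ex _ D _ R _ _ (fun v => sync_cat
  (sync_flatten 0 (enum_uniq 'I_n) (fun k => sync_prefix_block k (s_small k)))
  (sync_cat (sync_flatten (0, 0) (enum_uniq 'I_n) (fun k => sync_tail_block k (v k)))
    (sync_poly_block _ _))).
move=> _; apply: fin_index_ext => w; rewrite langP; split.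
  move=> [[m [c cd]] [[v [_ [/= cE cdE]]] ->]].
  exists [ffun k => m k], (fun k => (c k).1), cd.1, (fun k => (c k).2), cd.2.
  split.
    split=> [k|]; first by case: (cE k (mem_enum _ k)).
    have E1 : \sum_k (v k).1 = \sum_k (c k).1`_0.
      by apply: eq_bigr => k _; case: (cE k (mem_enum _ k)) => _ <-.
    have E2 : \sum_k (v k).2 = \sum_k (c k).2`_0.
      by apply: eq_bigr => k _; case: (cE k (mem_enum _ k)) => _ <-.
    by rewrite -E1 -E2.
  rewrite !nf_wordE; congr (conv (flatten _ ++ _) (flatten _ ++ _)).
    by apply: eq_map => k; rewrite ffunE.
  by apply: eq_map => k; rewrite !ffunE.
move=> [m [c [cd [c' [cd' [[cE cdE] ->]]]]]].
exists (fun k => m k, (fun k => (c k, c' k), (cd, cd'))); split.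
  exists [ffun k => ((c k)`_0, (c' k)`_0)]; split=> //; split=> /=.
    by move=> k _; rewrite ffunE.
  by under eq_bigr do rewrite ffunE; under [in RHS]eq_bigr do rewrite ffunE.
rewrite !nf_wordE /=; congr (conv _ (flatten _ ++ _)).
by apply: eq_map => k; rewrite ffunE.
Qed.

End Generators.

(** * The equation for R'' for both types of generators *)

Section Steps.
Variables (q n : nat) (l : 'I_n -> 'Z_q).

Lemma num_Rprime N (g : gelt q n) :
  num l N (Rprime g) = num l (fun k => N k - g.1 k) g.2.
Proof. by rewrite num_shift; apply: eq_num => k; rewrite ffunE. Qed.

Lemma clears_bound (g : gelt q n) (N : nat) k :
  (\sum_k (`|g.1 k| + `|g.2.2 k|) <= N)%N -> 0 <= g.2.2 k + (N%:Z - g.1 k).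
Proof. by rewrite (bigD1 k) //=; lia. Qed.

Lemma gen1_step i b (g : gelt q n) : exists N0 : nat, forall N : nat, (N0 <= N)%N ->
  lin l i * num l (fun=> N%:Z) (Rprime (gmul l g (gen1 i b))) =
  factor 0 1 * num l (fun=> N%:Z) (Rprime g) + b%:P * \prod_(k < n) lin l k ^+ N.
Proof.
(* The extra 1 makes room for the exponents of the generator. *)
exists (\sum_k (`|g.1 k| + `|g.2.2 k|) + 1)%N => N leN.
have gN k := @clears_bound g (N - 1) k ltac:(lia).
have gN' : clears (fun k => N%:Z - g.1 k - (gen1 i b).1 k) g.2.
  by move=> k; have := gN k; rewrite ffunE; case: (k == i); lia.
have sN : clears (fun k => N%:Z - (gen1 i b).1 k) (gen1 i b).2.
  by move=> k; rewrite !ffunE; case: (k == i); lia.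
rewrite Rprime_gmul_num // mulrDr !num_lin // num_Rprime /factor scale0r add0r mul1r.
congr (_ + _); first by apply: eq_num => k; rewrite ffunE subrK.
rewrite /num /=; congr (_ * _); apply: eq_bigr => k _.
by rewrite !ffunE subrK add0r.
Qed.

(** Here [R''] is [R' + b / u_j] divided by [u_i / u_j], and clearing [u_j] gives
    [u_i R'' = u_j R' + b]. *)
Lemma gen2_step i j b (g : gelt q n) : i != j ->
  exists N0 : nat, forall N : nat, (N0 <= N)%N ->
  lin l i * num l (fun=> N%:Z) (Rprime (gmul l g (gen2 i j b))) =
  factor 1 (l j) * num l (fun=> N%:Z) (Rprime g) + b%:P * \prod_(k < n) lin l k ^+ N.
Proof.
move=> ij; exists (\sum_k (`|g.1 k| + `|g.2.2 k|) + 1)%N => N leN.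
have gN k := @clears_bound g (N - 1) k ltac:(lia).
have gN1 : clears (fun k => N%:Z - g.1 k) g.2.
  by move=> k; have := gN k; lia.
have gN' : clears (fun k => N%:Z - g.1 k - (gen2 i j b).1 k) g.2.
  by move=> k; have := gN k; rewrite ffunE; case: (k == i); case: (k == j); lia.
have sN : clears (fun k => N%:Z - (gen2 i j b).1 k) (gen2 i j b).2.
  by move=> k; rewrite !ffunE; case: (k == i); case: (k == j); lia.
rewrite Rprime_gmul_num // mulrDr !num_lin // num_Rprime /factor scale1r.
rewrite -/(lin l j) num_lin //.
congr (_ + _).
  by apply: eq_num => k; rewrite ffunE; case: (k == i); case: (k == j) => /=; lia.
rewrite /num /=; congr (_ * _); apply: eq_bigr => k _; congr (_ ^+ _).
by rewrite !ffunE -[RHS]/(posn N%:Z); congr posn; ring.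
Qed.

End Steps.

Theorem theorem5p1 (q d : nat) (l : 'I_d.-1 -> 'Z_q) (s : gelt q d.-1) :
  (1 < q)%N -> (3 <= d)%N ->
  (forall i j : 'I_d.-1, i != j -> l i - l j \is a GRing.unit) ->
  (forall i : 'I_d.-1, l i \is a GRing.unit) ->
  ((exists (i : 'I_d.-1) (b : 'Z_q), s = gen1 i b) \/
   (exists (i j : 'I_d.-1) (b : 'Z_q), (i < j)%N /\ s = gen2 i j b)) ->
  regular (lang l s).
Proof.
move=> _ _ l_unit _ [[i [b ->]]|[i [j [b [ltij ->]]]]].
  apply: (lang_regular l_unit (i := i) (b := b) (lam := 0) (mu := 1)); first by left.
    by move=> k; rewrite ffunE; case: eqP.
  exact: gen1_step.
have ij : i != j by apply: contraTneq ltij => ->; rewrite ltnn.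
apply: (lang_regular l_unit (i := i) (b := b) (lam := 1) (mu := l j)).
- by right; split=> //; exists j.
- by move=> k; rewrite ffunE; case: eqP; case: eqP.
- by move=> g; apply: gen2_step.
Qed.
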